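(* Let $\Delta\ge 2$ and $n$ be positive integers and $N=2^{84\Delta+2}\Delta^{32\Delta}n$. For every $2$-edge-coloring of $K_N$, at least one of the color classes contains a copy of every graph on $n$ vertices with maximum degree $\Delta$. *)

(* Defs.v *)
From mathcomp Require Import all_boot.

Set Implicit Arguments.
Unset Strict Implicit.
Unset Printing Implicit Defensive.

Record sgraph := SGraph {
  vertex :> finType;
  adj : rel vertex;
  adj_sym : symmetric adj;
  adj_irrefl : irreflexive adj
}.

Definition max_degree (G : sgraph) : nat :=
  \max_(x : G) #|[set y : G | adj x y]|.

(* A copy is a subgraph isomorphic to H, not necessarily induced. *)
Definition contains_copy (G H : sgraph) : Prop :=
  exists2 f : H -> G, injective f & forall x y : H, adj x y -> adj (f x) (f y).

(* An edge of K_N is a 2-element subset of 'I_N. Colors are the booleans, and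
   the values of a coloring on sets of other sizes are irrelevant: only pairs
   of distinct vertices are looked at in [color_adj]. *)
Definition edge_coloring (N : nat) := {set 'I_N} -> bool.

Definition color_adj (N : nat) (chi : edge_coloring N) (b : bool) : rel 'I_N :=
  fun x y => (x != y) && (chi [set x; y] == b).

Lemma color_adj_sym N (chi : edge_coloring N) b : symmetric (color_adj chi b).
Proof. by move=> x y; rewrite /color_adj eq_sym setUC. Qed.

Lemma color_adj_irrefl N (chi : edge_coloring N) b :
  irreflexive (color_adj chi b).
Proof. by move=> x; rewrite /color_adj eqxx. Qed.

Definition color_class N (chi : edge_coloring N) (b : bool) : sgraph :=
  SGraph (color_adj_sym chi b) (color_adj_irrefl chi b).

(* Main.v *)
Require Import Defs.
From mathcomp Require Import all_boot.
From mathcomp Require Import zify.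

(** Call a colour robustly [a]-universal if it contains every [n]-vertex graph
    of maximum degree [a], even when a few candidates are removed at each vertex.
    A dichotomy is proved by induction on [a + b]: in a set of size
    [4 * (64 * Delta ^ 2) ^ (2 * (a + b)) * n], a colour [c] is [a]-universal or
    the other colour [~~ c] is [b]-universal.  Take [b <= a].  If no pair of
    subsets of relative size about [(32 * Delta ^ 2) ^ (- b)] is sparse in
    [~~ c], the greedy embedding works in [~~ c].  Otherwise there is a pair
    [(X, Y)] that is almost complete in [c].  Apply induction with [(a / 2, b)]
    inside [X], discard the half of [Y] that sees too much of colour [~~ c]
    towards the sets found in [X], and apply induction again in the rest of [Y].
    A maximum cut splits a graph of degree [a] in two parts of degree at most
    [a / 2], which are embedded in [Y] and then in [X].  Always paying for the
    smaller of the two degrees makes the losses a geometric series of total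
    exponent [O(Delta)], hence [Delta ^ O(Delta)]. *)

Set Implicit Arguments.
Unset Strict Implicit.
Unset Printing Implicit Defensive.

(** * Degrees inside a vertex set and maximum cuts *)

Definition deg_in (H : sgraph) (S : {set H}) (v : H) : nat :=
  #|[set u in S | adj v u]|.

Lemma card_setIdE (T : finType) (A : {set T}) (P : pred T) :
  #|[set x in A | P x]| = \sum_(x in A) P x.
Proof.
rewrite -sum1_card (big_mkcond (fun x => x \in A)) /= big_mkcond.
by apply: eq_bigr => x _; rewrite inE; case: (x \in A); case: (P x).
Qed.

Lemma deg_inE (H : sgraph) (S : {set H}) v :
  deg_in S v = \sum_(u in S) adj v u.
Proof. exact: card_setIdE. Qed.

Lemma deg_in_max (H : sgraph) (S : {set H}) v : deg_in S v <= max_degree H.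
Proof.
apply: leq_trans (leq_bigmax v).
by apply: subset_leq_card; apply/subsetP => u; rewrite !inE => /andP[].
Qed.

Lemma deg_inD1 (H : sgraph) (S : {set H}) u v :
  v \in S -> deg_in S u = adj u v + deg_in (S :\ v) u.
Proof. by move=> vS; rewrite !deg_inE (big_setD1 v). Qed.

Lemma deg_in_split (H : sgraph) (S A : {set H}) v : A \subset S ->
  deg_in S v = deg_in A v + deg_in (S :\: A) v.
Proof.
by move=> /setIidPr SA; rewrite !deg_inE (big_setID A) /= SA.
Qed.

(** Twice the number of edges inside [S]. *)
Definition inner_degree (H : sgraph) (S : {set H}) : nat :=
  \sum_(v in S) deg_in S v.

Lemma inner_degreeD1 (H : sgraph) (S : {set H}) v : v \in S ->
  inner_degree S = inner_degree (S :\ v) + 2 * deg_in S v.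
Proof.
move=> vS; rewrite /inner_degree (big_setD1 v) //=.
under eq_bigr => u _ do rewrite (deg_inD1 u vS).
rewrite big_split /=.
have -> : \sum_(u in S :\ v) adj u v = deg_in S v.
  rewrite deg_inE (big_setD1 v vS) /= adj_irrefl add0n.
  by apply: eq_bigr => u _; rewrite adj_sym.
lia.
Qed.

(** Choose [A] minimising the number of edges inside the two sides: moving one vertex across then
    gains nothing. *)
Lemma max_cut (H : sgraph) (S : {set H}) :
  exists2 A : {set H}, A \subset S &
    (forall v, v \in A -> 2 * deg_in A v <= deg_in S v) /\
    (forall v, v \in S :\: A -> 2 * deg_in (S :\: A) v <= deg_in S v).
Proof.
pose phi (A : {set H}) := inner_degree A + inner_degree (S :\: A).
case: (@arg_minnP _ S (fun A : {set H} => A \subset S) phi (subxx S)).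
move=> A AS Amin.
exists A => //; split=> v.
- move=> vA; have vS := subsetP AS _ vA.
  have := Amin (A :\ v) (subset_trans (subsetDl _ _) AS).
  have vSA : v \in S :\: (A :\ v) by rewrite !inE eqxx vS.
  rewrite /phi (inner_degreeD1 vA) (inner_degreeD1 vSA).
  have E : S :\: (A :\ v) :\ v = S :\: A.
    by apply/setP => u; rewrite !inE; case: eqP => [->|]; rewrite ?vA.
  by rewrite (deg_inD1 v vSA) adj_irrefl E (deg_in_split v AS); lia.
- rewrite inE => /andP[vA vS].
  have AvS : v |: A \subset S by rewrite subUset sub1set vS.
  have := Amin _ AvS.
  have vSA : v \in S :\: A by rewrite inE vA.
  have vvA : v \in v |: A by rewrite setU11.
  have E : S :\: A :\ v = S :\: (v |: A).
    by apply/setP => u; rewrite !inE; case: eqP.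
  rewrite /phi (inner_degreeD1 vSA) (inner_degreeD1 vvA) E (setU1K vA).
  by rewrite (deg_inD1 v vvA) adj_irrefl (setU1K vA) (deg_in_split v AS); lia.
Qed.

(** * Greedy embedding in the absence of sparse pairs *)

Definition embeds (T : finType) (e : rel T) (H : sgraph) (S : {set H})
    (C : H -> {set T}) : Prop :=
  exists f : H -> T, [/\ {in S &, injective f},
    forall v, v \in S -> f v \in C v &
    {in S &, forall u v, adj u v -> e (f u) (f v)}].

Definition sparse_pair (T : finType) (e : rel T) (W : {set T}) (K R : nat)
    (X Y : {set T}) : bool :=
  [&& X \subset W, Y \subset W, #|W| <= K * #|X|, #|W| <= K * #|Y| &
      [forall x in X, R * #|[set y in Y | e x y]| < #|Y|]].

Lemma card_bigcup_le (I T : finType) (P : pred I) (F : I -> {set T}) :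
  #|\bigcup_(i | P i) F i| <= \sum_(i | P i) #|F i|.
Proof.
elim/big_ind2: _ => [|A m B p Am Bp|//]; first by rewrite cards0.
by apply: leq_trans (leq_add Am Bp); exact: leq_card_setU.
Qed.

(** Vertices are embedded one by one, and [F] collects the images used so far. Each embedded
    neighbour shrinks a candidate set by a factor at most [R]; the exponent [b - deg_in S v] leaves
    room for the neighbours that have already left [S]. *)
Lemma greedy_embedding (T : finType) (e : rel T) (W : {set T}) (R b n : nat)
    (H : sgraph) (S : {set H}) (C : H -> {set T}) (F : {set T}) :
  symmetric e -> 0 < R -> 0 < #|W| -> 4 * R ^ b * n <= #|W| ->
  (0 < b -> forall X Y, ~~ sparse_pair e W ((4 * R) ^ b) R X Y) ->
  (forall v, v \in S -> deg_in S v <= b) ->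
  (forall v, v \in S -> C v \subset W) ->
  (forall v, v \in S -> #|W| <= 2 * R ^ (b - deg_in S v) * #|C v|) ->
  #|F| + #|S| <= n ->
  embeds e S (fun v => C v :\: F).
Proof.
move=> e_sym R0 W0 Wn nsp.
have [k] := ubnP #|S|; elim: k => // k IH in S C F * => Sk degS CW Csize Fn.
have [S0|[v vS]] := set_0Vmem S.
  have [x0 _] := card_gt0P W0.
  by exists (fun _ => x0); split=> [u w|u|u w]; rewrite S0 inE.
pose bad u := [set x in C v | R * #|[set y in C u | e x y]| < #|C u|].
pose Nv := [set u in S | adj v u].
have Rexp i : R ^ (b - i) <= R ^ b by rewrite leq_pexp2l // leq_subr.
(* A large [bad u] would form a sparse pair with [C u]. *)
have badsize u : u \in Nv -> (4 * R) ^ b * #|bad u| < #|W|.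
  rewrite inE => /andP[uS vu]; rewrite ltnNge; apply/negP => Hbad.
  have b1 : 0 < b.
    by apply: leq_trans (degS _ uS); rewrite (deg_inD1 u vS) adj_sym vu.
  move: (nsp b1 (bad u) (C u)); rewrite /sparse_pair Hbad CW //=.
  have -> : bad u \subset W.
    by apply: subset_trans (CW _ vS); apply/subsetP => x; rewrite inE => /andP[].
  have -> : #|W| <= (4 * R) ^ b * #|C u|.
    apply: leq_trans (Csize _ uS) _; rewrite leq_mul2r expnMn leq_mul ?orbT //.
    by apply: (@leq_trans (4 ^ 1)) => //; rewrite leq_exp2l.
  by move=> /= /negP; apply; apply/forall_inP => x; rewrite inE => /andP[].
(* At most [b] neighbours remain, and [4 * b <= 4 ^ b] absorbs their number; hence the 4 in the
   threshold [(4 * R) ^ b]. *)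
have badsum : 4 * R ^ b * \sum_(u in Nv) #|bad u| <= #|W|.
  have [b0|b0] := posnP b.
    have -> : Nv = set0.
      by apply: cards0_eq; apply/eqP; rewrite -leqn0 -b0; apply: degS vS.
    by rewrite big_set0 muln0.
  have b4 : 4 * b <= 4 ^ b.
    by elim: (b) => // -[|i] // IHi; rewrite expnS; lia.
  rewrite -(leq_pmul2l b0).
  apply: (@leq_trans (\sum_(u in Nv) #|W|)).
    rewrite !big_distrr /=; apply: leq_sum => u uN; apply/ltnW.
    apply: leq_ltn_trans (badsize u uN).
    by rewrite expnMn !mulnA leq_mul2r [b * 4]mulnC leq_mul2r b4 !orbT.
  rewrite sum_nat_const leq_mul2r; apply/orP; right; exact: degS vS.
have [x [xC xF xbad]] : exists x, [/\ x \in C v, x \notin F &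
    forall u, u \in Nv -> x \notin bad u].
  (* [C v] has at least [#|W| / (2 * R ^ b)] elements; [F] and the bad sets take at most half of
     that each, [F] strictly less. *)
  have : ~~ (C v \subset F :|: \bigcup_(u in Nv) bad u).
    apply/negP => /subset_leq_card.
    rewrite leqNgt => /negP; apply.
    apply: leq_ltn_trans (_ : #|F| + \sum_(u in Nv) #|bad u| < _).
      apply: leq_trans (leq_add (leqnn _) (card_bigcup_le _ _)).
      exact: leq_card_setU.
    have h1 := Csize _ vS.
    have h2 := Rexp (deg_in S v).
    have h3 : #|F| < n.
      by apply: leq_trans Fn; rewrite -addn1 leq_add2l; apply/card_gt0P; exists v.
    have h4 : 0 < R ^ b by rewrite expn_gt0 R0.
    move: (R ^ b) (R ^ _) (\sum_(_ in _) _) h1 h2 h4 Wn badsum => r r' s.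
    move=> *; nia.
  move=> /subsetPn[x xC]; rewrite !inE negb_or => /andP[xF xb].
  exists x; split=> // u uN; apply: contra xb => xu; apply/bigcupP; by exists u.
pose C' u := if adj v u then [set y in C u | e x y] else C u.
have C'C u : C' u \subset C u.
  by rewrite /C'; case: adj => //; apply/subsetP => y; rewrite inE => /andP[].
have [f [finj fC fadj]] : embeds e (S :\ v) (fun u => C' u :\: (x |: F)).
  apply: IH.
  - by move: Sk; rewrite (cardsD1 v) vS.
  - move=> u; rewrite inE => /andP[_ uS]; apply: leq_trans (degS _ uS).
    by rewrite (deg_inD1 u vS) leq_addl.
  - move=> u; rewrite inE => /andP[_ uS]; exact: subset_trans (C'C u) (CW _ uS).
  - move=> u; rewrite inE => /andP[_ uS]; have := Csize _ uS.
    have := degS _ uS.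
    rewrite (deg_inD1 u vS) /C' adj_sym; case vu: (adj v u) => //= hd hW.
    have := xbad u; rewrite /Nv !inE uS vu xC /= => /(_ isT).
    rewrite -leqNgt => hx; apply: leq_trans hW _.
    have -> : b - deg_in (S :\ v) u = (b - (1 + deg_in (S :\ v) u)).+1 by lia.
    by rewrite expnSr mulnA -[X in _ <= X]mulnA leq_mul2l hx orbT.
  - by rewrite cardsU1 xF; move: Fn; rewrite (cardsD1 v S) vS; lia.
exists (fun u => if u == v then x else f u).
have fne u : u \in S -> u != v -> f u != x.
  move=> uS uv; have := fC u; rewrite !inE uv uS => /(_ isT) /andP[].
  by rewrite negb_or => /andP[].
have fadjx u : u \in S -> u != v -> adj v u -> e x (f u).
  move=> uS uv vu; have := fC u; rewrite !inE uv uS => /(_ isT) /andP[_].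
  by rewrite /C' vu inE => /andP[].
split.
- move=> u w uS wS /=; case: eqP => [->|/eqP uv]; case: eqP => [->|/eqP wv] //.
  + by move=> E; move: (fne w wS wv); rewrite -E eqxx.
  + by move=> E; move: (fne u uS uv); rewrite E eqxx.
  + by apply: finj; rewrite !inE ?uv ?wv.
- move=> u uS /=; case: eqP => [->|/eqP uv]; first by rewrite inE xF.
  have := fC u; rewrite !inE uv uS => /(_ isT) /andP[].
  by rewrite negb_or => /andP[_ ->] /(subsetP (C'C u)).
- move=> u w uS wS /=; case: eqP => [->|/eqP uv]; case: eqP => [->|/eqP wv].
  + by rewrite adj_irrefl.
  + exact: fadjx.
  + by rewrite adj_sym e_sym; apply: fadjx.
  + by apply: fadj; rewrite !inE ?uv ?wv.
Qed.

(** * Universality with respect to families of candidate sets *)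

(** [part] distributes the vertices of [S] over the sets of [L], and [D v] is the
    set of forbidden images of [v]: [Delta - deg_in S v] and [n - #|S|] bound the
    numbers of previously embedded neighbours of [v] and of all previously
    embedded vertices, each neighbour being allowed to forbid a fraction
    [1 / (4 * Delta)] of [part v]. *)
Definition universal (T : finType) (e : rel T) (Delta n a : nat)
    (L : seq {set T}) : Prop :=
  forall (H : sgraph) (S : {set H}), max_degree H <= Delta -> #|S| <= n ->
  (forall v, v \in S -> deg_in S v <= a) ->
  exists2 part : H -> {set T}, forall v, v \in S -> part v \in L &
  forall D : H -> {set T},
  (forall v, v \in S -> 4 * Delta * #|part v :&: D v| <=
     (Delta - deg_in S v) * #|part v| + 4 * Delta * (n - #|S|)) ->
  embeds e S (fun v => part v :\: D v).

(** The bound on [D] and [4 * n <= #|W|] leave every vertex at least half of [W], which is the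
    factor 2 allowed by [greedy_embedding]. *)
Lemma universal_leaf (T : finType) (e : rel T) (W : {set T})
    (R b n Delta : nat) :
  symmetric e -> 0 < R -> 0 < n -> 0 < Delta -> 4 * R ^ b * n <= #|W| ->
  (0 < b -> forall X Y, ~~ sparse_pair e W ((4 * R) ^ b) R X Y) ->
  universal e Delta n b [:: W].
Proof.
move=> e_sym R0 n0 D0 Wn nsp H S Hdeg Sn degS.
exists (fun _ => W) => [v _|D Dsmall]; first by rewrite inE.
have Rb : 0 < R ^ b by rewrite expn_gt0 R0.
have W0 : 0 < #|W| by apply: leq_trans Wn; rewrite !muln_gt0 Rb n0.
have [] := @greedy_embedding T e W R b n H S (fun v => W :\: D v) set0 => //.
- by move=> v _; apply: subsetDl.
- move=> v vS; have := Dsmall v vS; have := cardsID (D v) W.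
  have Wn4 : 4 * n <= #|W| by apply: leq_trans Wn; nia.
  have : 0 < R ^ (b - deg_in S v) by rewrite expn_gt0 R0.
  move: (#|W :&: _|) (#|W :\: _|) (R ^ _) => p q r r0 pq hp.
  have : 4 * Delta * p <= 4 * Delta * n + Delta * #|W| by nia.
  have -> : 4 * Delta * n + Delta * #|W| = Delta * (4 * n + #|W|) by lia.
  rewrite -mulnA mulnCA leq_pmul2l // => hp'.
  have : #|W| <= 2 * q by lia.
  nia.
- by rewrite cards0.
move=> f [finj fC fadj]; exists f; split=> // v vS.
by have := fC v vS; rewrite !inE.
Qed.

(** After a maximum cut, [S2] is embedded through [L2] first, then [S1] through [L1], avoiding the
    [ebar]-neighbours of the images of [S2]. *)
Lemma universal_cat (T : finType) (e ebar : rel T) (Delta n a : nat)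
    (L1 L2 : seq {set T}) :
  symmetric e -> 0 < Delta ->
  (forall x y, x != y -> ~~ ebar x y -> e x y) ->
  (forall A B y, A \in L1 -> B \in L2 -> y \in B ->
     4 * Delta * #|[set x in A | ebar y x]| <= #|A|) ->
  universal e Delta n a./2 L1 -> universal e Delta n a./2 L2 ->
  universal e Delta n a (L1 ++ L2).
Proof.
move=> e_sym D0 ebarP sparse U1 U2 H S Hdeg Sn degS.
have [S1 S1S [half1 half2]] := max_cut S.
set S2 := S :\: S1 in half2.
have cS : #|S| = #|S1| + #|S2|.
  by rewrite -(cardsID S1 S) (setIidPr S1S).
have sS v : v \in S -> v \notin S1 -> v \in S2 by move=> *; rewrite inE; apply/andP.
have S2S v : v \in S2 -> v \in S by rewrite inE => /andP[].
have S21 v : v \in S2 -> v \notin S1 by rewrite inE => /andP[].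
have [||part1 part1L emb1] := U1 H S1 Hdeg; first lia.
  by move=> v vS; have := degS _ (subsetP S1S _ vS); have := half1 _ vS; lia.
have [||part2 part2L emb2] := U2 H S2 Hdeg; first lia.
  by move=> v vS; have := degS _ (S2S _ vS); have := half2 _ vS; lia.
exists (fun v => if v \in S1 then part1 v else part2 v) => [v vS|D Dsmall].
  rewrite mem_cat; case: (boolP (v \in S1)) => vS1; first by rewrite part1L.
  by rewrite part2L ?orbT // sS.
have [v vS2|f2 [inj2 fC2 fadj2]] := emb2 D.
  have := Dsmall v (S2S _ vS2); rewrite (negbTE (S21 _ vS2)) => h.
  apply: leq_trans h _; apply: leq_add.
    by rewrite leq_mul2r leq_sub2l ?orbT // (deg_in_split v S1S) leq_addl.
  by rewrite leq_mul2l leq_sub2l ?orbT // cS leq_addl.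
pose D1 v := D v :|: f2 @: S2 :|:
  \bigcup_(u in [set u in S2 | adj v u]) [set x | ebar (f2 u) x].
have [v vS1|f1 [inj1 fC1 fadj1]] := emb1 D1.
  have vS := subsetP S1S _ vS1.
  have := Dsmall v vS; rewrite vS1.
  have dS := leq_trans (deg_in_max S v) Hdeg.
  have h : #|part1 v :&: D1 v| <= #|part1 v :&: D v| + #|S2| +
      \sum_(u in [set u in S2 | adj v u]) #|[set x in part1 v | ebar (f2 u) x]|.
    rewrite /D1 !setIUr big_distrr /=.
    apply: leq_trans (leq_card_setU _ _) _; apply: leq_add.
      apply: leq_trans (leq_card_setU _ _) _; rewrite leq_add2l.
      apply: leq_trans (leq_imset_card f2 _).
      by rewrite subset_leq_card // subsetIr.
    apply: leq_trans (card_bigcup_le _ _) _; apply: leq_sum => u _.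
    by rewrite subset_leq_card //; apply/subsetP => x; rewrite !inE.
  have h2 : 4 * Delta *
      \sum_(u in [set u in S2 | adj v u]) #|[set x in part1 v | ebar (f2 u) x]|
      <= deg_in S2 v * #|part1 v|.
    rewrite big_distrr /= /deg_in -sum_nat_const; apply: leq_sum => u.
    rewrite inE => /andP[uS2 _]; apply: (sparse _ (part2 u)).
    + exact: part1L.
    + exact: part2L.
    + by have := fC2 u uS2; rewrite inE => /andP[].
  rewrite (deg_in_split v S1S) -/S2 in dS *.
  move: (\sum_(_ in _) _) h h2 => s h h2 h3.
  have h4 := leq_mul (leqnn (4 * Delta)) h.
  (* From [S] to [S1] the allowance grows by [deg_in S2 v] neighbours and [#|S2|] vertices, which
     pays for the two new terms of [D1]. *)
  have -> : Delta - deg_in S1 v =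
    (Delta - (deg_in S1 v + deg_in S2 v)) + deg_in S2 v by lia.
  have -> : n - #|S1| = (n - #|S|) + #|S2| by lia.
  by rewrite !mulnDl !mulnDr in h4 *; lia.
have cross u v : u \in S1 -> v \in S2 -> f1 u != f2 v.
  move=> uS vS; have := fC1 u uS; rewrite !inE !negb_or.
  move=> /andP[/andP[/andP[_ h] _] _]; apply: contra h => /eqP ->.
  exact: imset_f.
have crossadj u v : u \in S1 -> v \in S2 -> adj u v -> e (f1 u) (f2 v).
  move=> uS vS uv; rewrite e_sym; apply: ebarP; first by rewrite eq_sym cross.
  have := fC1 u uS; rewrite !inE !negb_or => /andP[/andP[_ h] _].
  apply: contra h => h; apply/bigcupP.
  by exists v; rewrite !inE ?uv ?andbT // -in_setD.
exists (fun v => if v \in S1 then f1 v else f2 v); split.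
- move=> u v uS vS /=.
  case: (boolP (u \in S1)) => u1; case: (boolP (v \in S1)) => v1.
  + exact: inj1.
  + by move=> E; move: (cross u v u1 (sS _ vS v1)); rewrite E eqxx.
  + by move=> E; move: (cross v u v1 (sS _ uS u1)); rewrite E eqxx.
  + by apply: inj2; apply: sS.
- move=> v vS /=; case: (boolP (v \in S1)) => v1; last exact: fC2 (sS _ vS v1).
  by have := fC1 v v1; rewrite !inE !negb_or => /andP[/andP[/andP[-> _] _] ->].
- move=> u v uS vS /=.
  case: (boolP (u \in S1)) => u1; case: (boolP (v \in S1)) => v1.
  + exact: fadj1.
  + by apply: crossadj => //; apply: sS.
  + by rewrite adj_sym e_sym; apply: crossadj => //; apply: sS.
  + by apply: fadj2; apply: sS.
Qed.

(** Double counting: a given [A] in [L] excludes at most [#|Y| / (2 * Delta)]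
    elements of [Y], and there are at most [Delta] such sets. *)
Lemma sparse_side (T : finType) (e : rel T) (Delta : nat) (X Y : {set T})
    (L : seq {set T}) :
  symmetric e -> 0 < Delta -> size L <= Delta ->
  (forall x, x \in X -> 8 * Delta ^ 2 * #|[set y in Y | e x y]| <= #|Y|) ->
  {in L, forall A : {set T}, A \subset X} ->
  exists2 Y' : {set T}, Y' \subset Y /\ #|Y| <= 2 * #|Y'| &
    forall A y, A \in L -> y \in Y' ->
      4 * Delta * #|[set x in A | e y x]| <= #|A|.
Proof.
move=> e_sym D0 sL spX LX.
pose bad (A : {set T}) := [set y in Y | #|A| < 4 * Delta * #|[set x in A | e y x]|].
have badsize A : A \in L -> 2 * Delta * #|bad A| <= #|Y|.
  move=> AL.
  have [A0|A0] := posnP #|A|.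
    suff -> : bad A = set0 by rewrite cards0 muln0.
    apply/setP => y; rewrite !inE A0; apply/andP => -[_].
    suff -> : [set x in A | e y x] = set0 by rewrite cards0 muln0.
    by apply/setP => x; rewrite (cards0_eq A0) !inE.
  have dbl : \sum_(y in Y) #|[set x in A | e y x]| =
             \sum_(x in A) #|[set y in Y | e x y]|.
    under eq_bigr => y _ do rewrite card_setIdE.
    under [RHS]eq_bigr => y _ do rewrite card_setIdE.
    rewrite exchange_big; apply: eq_bigr => x _; apply: eq_bigr => y _.
    by rewrite e_sym.
  (* The number of [e]-pairs between [A] and [Y] is bounded below through [bad A], then above in
     [h2] through the sparsity seen from [X]. *)
  have h1 : #|bad A| * #|A| <=
      4 * Delta * \sum_(y in Y) #|[set x in A | e y x]|.
    rewrite -sum_nat_const big_distrr /= big_mkcond [X in _ <= X]big_mkcond /=.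
    apply: leq_sum => y _; rewrite inE; case: (y \in Y) => //=.
    by case: ltnP => // /ltnW.
  have h2 : 8 * Delta ^ 2 * \sum_(x in A) #|[set y in Y | e x y]| <=
      #|A| * #|Y|.
    rewrite big_distrr /= -sum_nat_const; apply: leq_sum => x xA.
    by apply: spX; apply: (subsetP (LX _ AL)).
  rewrite -(leq_pmul2l A0); apply: leq_trans h2; rewrite -dbl.
  have -> : #|A| * (2 * Delta * #|bad A|) = 2 * Delta * (#|bad A| * #|A|) by lia.
  apply: leq_trans (leq_mul (leqnn _) h1) _.
  by rewrite -mulnn; lia.
pose B := \bigcup_(A in L) bad A.
have BY : 2 * #|B| <= #|Y|.
  rewrite -(leq_pmul2l D0).
  have hB : #|B| <= \sum_(A in L) #|bad A| := card_bigcup_le _ _.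
  apply: (@leq_trans (2 * Delta * \sum_(A in L) #|bad A|)); first by nia.
  apply: (@leq_trans (\sum_(A in L) #|Y|)).
    by rewrite big_distrr /=; apply: leq_sum => A /badsize.
  by rewrite sum_nat_const leq_mul2r (leq_trans (card_size L) sL) orbT.
exists (Y :\: B).
  split; first exact: subsetDl.
  have := cardsID B Y; have := subset_leq_card (subsetIr Y B); lia.
move=> A y AL; rewrite inE => /andP[yB yY]; rewrite leqNgt.
apply: contra yB => h; apply/bigcupP.
by exists A => //; rewrite inE yY.
Qed.

(** * The dichotomy between the two colours *)

(** With [2 * a], a list for [a./2] has at most [Delta] sets, as [sparse_side] requires; [maxn 1]
    admits a single set when [a = 0]. *)
Definition has_universal (N : nat) (chi : edge_coloring N) (Delta n : nat)
    (W : {set 'I_N}) (c : bool) (a : nat) : Prop :=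
  exists L : seq {set 'I_N}, [/\ {in L, forall A : {set 'I_N}, A \subset W},
    size L <= maxn 1 (2 * a) & universal (color_adj chi c) Delta n a L].

Lemma has_universalS N (chi : edge_coloring N) Delta n (W X : {set 'I_N}) c a :
  X \subset W -> has_universal chi Delta n X c a ->
  has_universal chi Delta n W c a.
Proof.
by move=> XW [L [LX sL U]]; exists L; split=> // A /LX AX; apply: subset_trans XW.
Qed.

Lemma universal_dichotomy N (chi : edge_coloring N) (Delta n a b : nat)
    (c : bool) (W : {set 'I_N}) :
  0 < Delta -> 0 < n -> a <= Delta -> b <= Delta ->
  4 * (64 * Delta ^ 2) ^ (2 * (a + b)) * n <= #|W| ->
  has_universal chi Delta n W c a \/ has_universal chi Delta n W (~~ c) b.
Proof.
move=> D0 n0.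
have [k] := ubnP (a + b); elim: k => // k IH in a b c W *.
wlog ba : a b c / b <= a.
  move=> wl; case: (leqP b a) => [|/ltnW] ab; first exact: wl.
  move=> hk aD bD hW.
  have := wl b a (~~ c) ab; rewrite [b + a]addnC negbK => /(_ hk bD aD hW).
  by case; [right|left].
move=> hk aD bD hW.
set q := 64 * Delta ^ 2 in IH hW.
(* [R] is the sparsity required by [sparse_side]. Then [q = 2 * (4 * R)], where the 2 pays for
   discarding half of [Y]. *)
pose R := 8 * Delta ^ 2; have D2 : 0 < Delta ^ 2 by rewrite expn_gt0 D0.
have R0 : 0 < R by rewrite muln_gt0.
have q1 : 1 < q by rewrite /q; lia.
case: (boolP [&& 0 < b & [exists X, exists Y,
    sparse_pair (color_adj chi (~~ c)) W ((4 * R) ^ b) R X Y]]); last first.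
  move=> nsp; right; exists [:: W]; split.
  - by move=> A; rewrite inE => /eqP ->.
  - by rewrite leq_maxl.
  - apply: (@universal_leaf _ _ _ R) => //; first exact: color_adj_sym.
      apply: leq_trans hW; rewrite leq_mul2r leq_mul2l /=; apply/orP; right.
      apply: (@leq_trans (q ^ b)); last by rewrite leq_exp2l //; lia.
      by case: (b) => // b'; rewrite leq_exp2r // /q /R; lia.
    move=> b0 X Y; apply: contra nsp => h; rewrite b0 /=.
    by apply/existsP; exists X; apply/existsP; exists Y.
case/andP=> b0 /existsP[X /existsP[Y /and5P[XW YW cX cY /forall_inP sp]]].
have KR : 2 * (4 * R) ^ b <= q ^ b.
  have -> : q = 2 * (4 * R) by rewrite /q /R; lia.
  by rewrite (expnMn 2) leq_mul2r (@leq_pexp2l 2 1) ?orbT.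
(* Passing to a subset costs a factor [q ^ b], which is affordable because [b <= a] gives
   [2 * (a./2 + b) + b <= 2 * (a + b)]. *)
have big (Z : {set 'I_N}) : #|W| <= 2 * (4 * R) ^ b * #|Z| ->
    4 * q ^ (2 * (a./2 + b)) * n <= #|Z|.
  move=> hZ; have qb : 0 < q ^ b by rewrite expn_gt0; lia.
  rewrite -(leq_pmul2l qb); apply: leq_trans (leq_trans hZ _); last first.
    by rewrite leq_mul2r KR orbT.
  apply: leq_trans hW; rewrite mulnA leq_mul2r mulnCA -expnD.
  by rewrite leq_mul2l leq_exp2l //; lia.
have [||||[L1 [L1X sL1 U1]]|] := IH a./2 b c X; try lia.
- by apply: big; rewrite -mulnA (leq_trans cX) // leq_pmull.
- have sLD : size L1 <= Delta by lia.
  have spX x : x \in X ->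
      R * #|[set y in Y | color_adj chi (~~ c) x y]| <= #|Y| by move=> /sp /ltnW.
  have [Y' [Y'Y cY'] sp'] :=
    sparse_side (color_adj_sym chi (~~ c)) D0 sLD spX L1X.
  have Y'W := subset_trans Y'Y YW.
  have [||||[L2 [L2Y sL2 U2]]|] := IH a./2 b c Y'; try lia.
  + apply: big; rewrite [2 * _]mulnC -mulnA.
    by rewrite (leq_trans cY) // leq_mul2l cY' orbT.
  + left; exists (L1 ++ L2); split.
    * move=> A; rewrite mem_cat => /orP[/L1X|/L2Y] h; exact: subset_trans h _.
    * by rewrite size_cat; lia.
    * apply: (@universal_cat _ _ (color_adj chi (~~ c))) => //.
      - exact: color_adj_sym.
      - by move=> x y; rewrite /color_adj => -> /=; case: (chi _); case: (c).
      - by move=> A B y AL BL yB; apply: sp' => //; apply: (subsetP (L2Y _ BL)).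
  + by move/(has_universalS Y'W); right.
- by move/(has_universalS XW); right.
Qed.

Theorem theorem2p6 (Delta n : nat) (hDelta : 2 <= Delta) (hn : 0 < n)
    (chi : edge_coloring (2 ^ (84 * Delta + 2) * Delta ^ (32 * Delta) * n)) :
  exists b : bool, forall H : sgraph,
    #|H| = n -> max_degree H = Delta -> contains_copy (color_class chi b) H.
Proof.
have D0 : 0 < Delta by lia.
(* The dichotomy is used with both degrees equal to [Delta] on the whole vertex set; nothing is
   forbidden at the outset, so [D] is empty. *)
suff [b [L [_ _ U]]] : exists b, has_universal chi Delta n setT b Delta.
  exists b => H Hn Hdeg.
  have [||v _|part partL emb] := U H setT; rewrite ?Hdeg ?cardsT ?Hn //.
    by rewrite -Hdeg deg_in_max.
  have [v _|f [finj _ fadj]] := emb (fun _ => set0).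
    by rewrite setI0 cards0 muln0.
  by exists f => [u v|u v]; [apply: finj|apply: fadj]; rewrite inE.
have WN : 4 * (64 * Delta ^ 2) ^ (2 * (Delta + Delta)) * n <=
    #|[set: 'I_(2 ^ (84 * Delta + 2) * Delta ^ (32 * Delta) * n)]|.
  rewrite cardsT card_ord leq_mul2r; apply/orP; right.
  have -> : 4 * (64 * Delta ^ 2) ^ (2 * (Delta + Delta)) =
      2 ^ (24 * Delta + 2) * Delta ^ (8 * Delta).
    rewrite (expnMn 64) -expnM addnC expnD mulnA.
    have -> : 64 = 2 ^ 6 by [].
    by rewrite -expnM; congr (_ * 2 ^ _ * Delta ^ _); lia.
  by rewrite leq_mul // leq_pexp2l //; lia.
have [h|h] := universal_dichotomy chi true D0 hn (leqnn _) (leqnn _) WN.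
- by exists true.
- by exists false.
Qed.
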